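(* Let $N\ge1$ be an integer and let $J:\mathfrak{u}(2)^N\to\mathfrak{u}(2)^N$ be an $\mathbb{R}$-linear map. Then $J$ has zero torsion if and only if there exist $\Phi\in(SO(3)\times\mathbb{R}_+^* )^N$ and $M=(M^i_j)_{1\le i,j\le N}\in\mathfrak{gl}(2N,\mathbb{R})$, with $2\times2$ blocks $M^i_j=\begin{pmatrix}\xi^{4i-1}_{4j-1}&\xi^{4i-1}_{4j}\\ \xi^{4i}_{4j-1}&\xi^{4i}_{4j}\end{pmatrix}$, such that $\Phi^{-1}J\Phi=K(M)$, where $K(M)=(K^i_j(M))_{1\le i,j\le N}$ is the matrix with the following $4\times4$ blocks: $$K^i_i(M)=\left(\begin{array}{cc|c}0&1&0\\-1&0&0\\\hline 0&0&M^i_i\end{array}\right)\ (1\le i\le N),\qquad K^i_j(M)=\left(\begin{array}{cc|c}0&0&0\\0&0&0\\\hline 0&0&M^i_j\end{array}\right)\ (1\le i,j\le N,\ i\ne j).$$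
   Context: $\mathfrak{u}(2)^N$ is the direct sum of $N$ copies of $\mathfrak{u}(2)$, with basis $(J^{(1)}_1,J^{(1)}_2,J^{(1)}_3,J^{(1)}_4,\dots,J^{(N)}_1,J^{(N)}_2,J^{(N)}_3,J^{(N)}_4)$, where for each $k$: $[J^{(k)}_1,J^{(k)}_2]=J^{(k)}_3$, $[J^{(k)}_2,J^{(k)}_3]=J^{(k)}_1$, $[J^{(k)}_3,J^{(k)}_1]=J^{(k)}_2$, $J^{(k)}_4$ is central, and brackets between different factors vanish. Linear maps are identified with their matrices in this basis (columns are images of basis vectors). In matrices and block matrices, the upper index is the row index and the lower index the column index; $\mathfrak{gl}(2N,\mathbb{R})$ is the set of all real $2N\times2N$ matrices. $(SO(3)\times\mathbb{R}_+^* )^N$ denotes the group of block-diagonal matrices $\mathrm{diag}(\Phi_1,b_1,\dots,\Phi_N,b_N)$ with $\Phi_i\in SO(3)$ and $b_i>0$. A linear map $J:\mathfrak{g}\to\mathfrak{g}$ on a real Lie algebra (not necessarily with $J^2=-1$) has zero torsion if $[JX,JY]-[X,Y]-J[JX,Y]-J[X,JY]=0$ for all $X,Y\in\mathfrak{g}$. *)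

(* Defs.v *)
From HB Require Import structures.
From mathcomp Require Import all_boot all_order all_algebra.
From mathcomp Require Import reals.
From mathcomp Require Import ring.

Set Implicit Arguments.
Unset Strict Implicit.
Unset Printing Implicit Defensive.

Import Order.TTheory GRing.Theory Num.Theory.
Local Open Scope ring_scope.

HB.mixin Record Lmodule_isLieAlgebra (R : comNzRingType) L
    of GRing.Lmodule R L := {
  lie : L -> L -> L;
  lieDl : forall x y z, lie (x + y) z = lie x z + lie y z;
  lieZl : forall a x y, lie (a *: x) y = a *: lie x y;
  liexx : forall x, lie x x = 0;
  lieDr : forall x y z, lie x (y + z) = lie x y + lie x z;
  lieZr : forall a x y, lie x (a *: y) = a *: lie x y;
  lie_jacobi : forall x y z,
    lie x (lie y z) + lie y (lie z x) + lie z (lie x y) = 0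
}.

#[short(type="lieAlgType")]
HB.structure Definition LieAlgebra (R : comNzRingType) :=
  {L of GRing.Lmodule R L & Lmodule_isLieAlgebra R L}.

Definition zero_torsion (R : comNzRingType) (L : lieAlgType R)
    (J : {linear L -> L}) : Prop :=
  forall X Y : L,
    lie (J X) (J Y) - lie X Y - J (lie (J X) Y) - J (lie X (J Y)) = 0.

(* {ffun I -> L} is the direct sum of copies of L indexed by I.                *)
Section DirectSum.
Variables (R : comNzRingType) (I : finType) (L : lieAlgType R).
Implicit Types x y z : {ffun I -> L}.

Definition ffun_lie x y : {ffun I -> L} := [ffun i => lie (x i) (y i)].

Fact ffun_lieDl x y z : ffun_lie (x + y) z = ffun_lie x z + ffun_lie y z.
Proof. by apply/ffunP => i; rewrite !ffunE lieDl. Qed.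
Fact ffun_lieZl a x y : ffun_lie (a *: x) y = a *: ffun_lie x y.
Proof. by apply/ffunP => i; rewrite !ffunE lieZl. Qed.
Fact ffun_liexx x : ffun_lie x x = 0.
Proof. by apply/ffunP => i; rewrite !ffunE liexx. Qed.
Fact ffun_lieDr x y z : ffun_lie x (y + z) = ffun_lie x y + ffun_lie x z.
Proof. by apply/ffunP => i; rewrite !ffunE lieDr. Qed.
Fact ffun_lieZr a x y : ffun_lie x (a *: y) = a *: ffun_lie x y.
Proof. by apply/ffunP => i; rewrite !ffunE lieZr. Qed.
Fact ffun_lie_jacobi x y z :
  ffun_lie x (ffun_lie y z) + ffun_lie y (ffun_lie z x)
    + ffun_lie z (ffun_lie x y) = 0.
Proof. by apply/ffunP => i; rewrite !ffunE lie_jacobi. Qed.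

HB.instance Definition _ := Lmodule_isLieAlgebra.Build R {ffun I -> L}
  ffun_lieDl ffun_lieZl ffun_liexx ffun_lieDr ffun_lieZr ffun_lie_jacobi.
End DirectSum.

(* u(2) in coordinates: for k = 0, 1, 2, 3, the k-th coordinate is the         *)
(* coefficient of J_(k+1). The bracket is the bilinear extension of the        *)
(* relations proved in u2_lie_basis below.                                     *)
Definition u2 (R : realType) := 'cV[R]_4.

Section U2.
Variable R : realType.
HB.instance Definition _ := GRing.Lmodule.on (u2 R).
Implicit Types x y z : u2 R.

Definition u2_lie x y : u2 R :=
  \col_(k < 4) [:: x 1 0 * y 2 0 - x 2 0 * y 1 0;
                   x 2 0 * y 0 0 - x 0 0 * y 2 0;
                   x 0 0 * y 1 0 - x 1 0 * y 0 0;
                   0]`_k.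

Let colP4 x y : [/\ x 0 0 = y 0 0, x 1 0 = y 1 0, x 2 0 = y 2 0 & x 3 0 = y 3 0] ->
  x = y.
Proof.
case=> h0 h1 h2 h3; apply/matrixP => i j; rewrite ord1 {j}.
case: i => [[|[|[|[|//]]]]] lt_i.
- by rewrite (_ : Ordinal lt_i = 0) //; apply: val_inj.
- by rewrite (_ : Ordinal lt_i = 1) //; apply: val_inj.
- by rewrite (_ : Ordinal lt_i = 2) //; apply: val_inj.
- by rewrite (_ : Ordinal lt_i = 3) //; apply: val_inj.
Qed.

Fact u2_lieDl x y z : u2_lie (x + y) z = u2_lie x z + u2_lie y z.
Proof. by apply: colP4; split; rewrite !mxE /=; ring. Qed.
Fact u2_lieZl a x y : u2_lie (a *: x) y = a *: u2_lie x y.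
Proof. by apply: colP4; split; rewrite !mxE /=; ring. Qed.
Fact u2_liexx x : u2_lie x x = 0.
Proof. by apply: colP4; split; rewrite !mxE /=; ring. Qed.
Fact u2_lieDr x y z : u2_lie x (y + z) = u2_lie x y + u2_lie x z.
Proof. by apply: colP4; split; rewrite !mxE /=; ring. Qed.
Fact u2_lieZr a x y : u2_lie x (a *: y) = a *: u2_lie x y.
Proof. by apply: colP4; split; rewrite !mxE /=; ring. Qed.
Fact u2_lie_jacobi x y z :
  u2_lie x (u2_lie y z) + u2_lie y (u2_lie z x) + u2_lie z (u2_lie x y) = 0.
Proof. by apply: colP4; split; rewrite !mxE /=; ring. Qed.

HB.instance Definition _ := Lmodule_isLieAlgebra.Build R (u2 R)
  u2_lieDl u2_lieZl u2_liexx u2_lieDr u2_lieZr u2_lie_jacobi.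

Definition u2_basis (k : 'I_4) : u2 R := delta_mx k 0.

Lemma u2_lie_basis :
  [/\ lie (u2_basis 0) (u2_basis 1) = u2_basis 2,
      lie (u2_basis 1) (u2_basis 2) = u2_basis 0,
      lie (u2_basis 2) (u2_basis 0) = u2_basis 1
    & forall x, lie (u2_basis 3) x = 0].
Proof.
by split=> [|||x]; apply: colP4; split; rewrite !mxE //= ?mulr0n ?mulr1n; ring.
Qed.
End U2.

Notation u2N R N := {ffun 'I_N -> u2 R}.

Section U2N.
Variables (R : realType) (N : nat).

Definition u2N_basis (i : 'I_N) (k : 'I_4) : u2N R N :=
  [ffun j => if j == i then u2_basis R k else 0].

(* Block (i, j) has as (k, l) entry the coefficient of u2N_basis i k in        *)
(* J (u2N_basis j l), so that columns are images of basis vectors.             *)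
Definition matrix_of (J : {linear u2N R N -> u2N R N})
    : 'M[R]_(\sum_(i < N) 4) :=
  \mxblock_(i < N, j < N) \matrix_(k < 4, l < 4) J (u2N_basis j l) i k 0.

Definition SO (n : nat) (A : 'M[R]_n) : Prop :=
  A^T *m A = 1%:M /\ \det A = 1.

Definition Phi_block (A : 'M[R]_3) (b : R) : 'M[R]_4 :=
  block_mx A 0 0 b%:M : 'M[R]_(3 + 1).

Definition SO3_Rpos_pow (Phi : 'M[R]_(\sum_(i < N) 4)) : Prop :=
  exists (A : 'I_N -> 'M[R]_3) (b : 'I_N -> R),
    (forall i, SO (A i) /\ 0 < b i) /\
    Phi = \mxdiag_(i < N) Phi_block (A i) (b i).

Definition K_corner : 'M[R]_2 :=
  block_mx 0 1%:M (- 1%:M) 0 : 'M[R]_(1 + 1).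

Definition K_block (U V : 'M[R]_2) : 'M[R]_4 :=
  block_mx U 0 0 V : 'M[R]_(2 + 2).

(* The size of M is 2N; writing it \sum_(i < N) 2 records the division of M    *)
(* into its 2 x 2 blocks submxblock M i j.                                     *)
Definition Kmx (M : 'M[R]_(\sum_(i < N) 2)) : 'M[R]_(\sum_(i < N) 4) :=
  \mxblock_(i < N, j < N)
    K_block (if i == j then K_corner else 0) (submxblock M i j).
End U2N.

(* Main.v *)
Require Import Defs.
From HB Require Import structures.
From mathcomp Require Import all_boot all_order all_algebra.
From mathcomp Require Import reals.
From mathcomp Require Import ring lra.

Set Implicit Arguments.
Unset Strict Implicit.
Unset Printing Implicit Defensive.

Import Order.TTheory GRing.Theory Num.Theory.
Local Open Scope ring_scope.

(* Write J as 4 x 4 blocks B i j. By bilinearity zero torsion is a system of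
   equations in the blocks, indexed by triples of factors, and it is invariant
   under conjugation by automorphisms acting on each factor.

   Let A be the so(3) part of B i i. As J X x J Y = cof(A) (X x Y) and
   J X x Y + X x J Y = (tr A - A^T) (X x Y), Cayley-Hamilton turns the equation
   for the triple (i, i, i) into (A + A^T) (A^T - tr A) = 1 - s, where s is the
   second invariant of A. Rotating the axis of the skew part of A to the third
   coordinate axis, this forces A = [0, 1, 0; -1, 0, 0; 0, 0, r].

   With the diagonal blocks normalized, the pairs (J_2, J_3), (J_3, J_1) of
   factor j give two relations between the first two columns of B i j whose
   combination is a vanishing sum of squares. Then the pairs (J_1, Y), (J_2, Y),
   with Y = J_3 of another factor or Y = J_4 of any factor, make the first two
   coordinates a, b of J Y satisfy a = r b and b = - r a, so that a = b = 0. *)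

(** * Finite sums of brackets and sums over small index types *)

Section LieBig.
Variables (R : comNzRingType) (L : lieAlgType R).

Lemma lie0l (y : L) : lie 0 y = 0.
Proof. by have := lieZl 0 0 y; rewrite !scale0r. Qed.

Lemma lie0r (x : L) : lie x 0 = 0.
Proof. by have := lieZr 0 x 0; rewrite !scale0r. Qed.

Lemma lie_suml (I : Type) (r : seq I) (P : pred I) (F : I -> L) y :
  lie (\sum_(i <- r | P i) F i) y = \sum_(i <- r | P i) lie (F i) y.
Proof.
by apply: (big_morph (fun x => lie x y)) => [a b|]; rewrite ?lieDl ?lie0l.
Qed.

Lemma lie_sumr (I : Type) (r : seq I) (P : pred I) x (F : I -> L) :
  lie x (\sum_(i <- r | P i) F i) = \sum_(i <- r | P i) lie x (F i).
Proof. by apply: (big_morph (lie x)) => [a b|]; rewrite ?lieDr ?lie0r. Qed.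
End LieBig.

Lemma forall_ord3 (P : 'I_3 -> Prop) : P 0 -> P 1 -> P 2 -> forall i, P i.
Proof.
move=> P0 P1 P2 [[|[|[|//]]]] lt_i.
- by rewrite (_ : Ordinal lt_i = 0) //; apply: val_inj.
- by rewrite (_ : Ordinal lt_i = 1) //; apply: val_inj.
- by rewrite (_ : Ordinal lt_i = 2) //; apply: val_inj.
Qed.

Lemma forall_ord4 (P : 'I_4 -> Prop) :
  P 0 -> P 1 -> P 2 -> P 3 -> forall i, P i.
Proof.
move=> P0 P1 P2 P3 [[|[|[|[|//]]]]] lt_i.
- by rewrite (_ : Ordinal lt_i = 0) //; apply: val_inj.
- by rewrite (_ : Ordinal lt_i = 1) //; apply: val_inj.
- by rewrite (_ : Ordinal lt_i = 2) //; apply: val_inj.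
- by rewrite (_ : Ordinal lt_i = 3) //; apply: val_inj.
Qed.

Lemma sum_ord3 (V : nmodType) (F : 'I_3 -> V) :
  \sum_i F i = F 0 + F 1 + F 2.
Proof.
rewrite !big_ord_recr big_ord0 /= add0r.
by do !congr (_ + _); congr F; apply: val_inj.
Qed.

Lemma sum_ord4 (V : nmodType) (F : 'I_4 -> V) :
  \sum_i F i = F 0 + F 1 + F 2 + F 3.
Proof.
rewrite !big_ord_recr big_ord0 /= add0r.
by do !congr (_ + _); congr F; apply: val_inj.
Qed.

Lemma add_ord3 :
  [/\ 1 + 1 = 2 :> 'I_3, 1 + 2 = 0 :> 'I_3, 2 + 1 = 0 :> 'I_3
    & 2 + 2 = 1 :> 'I_3].
Proof. by split; exact: val_inj. Qed.

Lemma sqr_add_eq0 (R : realDomainType) (a b : R) :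
  a ^+ 2 + b ^+ 2 = 0 -> a = 0 /\ b = 0.
Proof.
move=> /eqP; rewrite paddr_eq0 ?sqr_ge0 // !sqrf_eq0.
by move=> /andP[/eqP-> /eqP->].
Qed.

(** * Coordinates in u(2) *)

Section U2.
Variable R : realType.
Implicit Types x y : u2 R.

Lemma u2P x y :
  [/\ x 0 0 = y 0 0, x 1 0 = y 1 0, x 2 0 = y 2 0 & x 3 0 = y 3 0] -> x = y.
Proof.
by case=> h0 h1 h2 h3; apply/matrixP => i j; rewrite ord1; elim/forall_ord4: i.
Qed.

Lemma lie0E x y : lie x y 0 0 = x 1 0 * y 2 0 - x 2 0 * y 1 0.
Proof. by rewrite mxE. Qed.

Lemma lie1E x y : lie x y 1 0 = x 2 0 * y 0 0 - x 0 0 * y 2 0.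
Proof. by rewrite mxE. Qed.

Lemma lie2E x y : lie x y 2 0 = x 0 0 * y 1 0 - x 1 0 * y 0 0.
Proof. by rewrite mxE. Qed.

Lemma lie3E x y : lie x y 3 0 = 0.
Proof. by rewrite mxE. Qed.

Lemma mul4_coord m n (A : 'M[R]_(m, 4)) (B : 'M[R]_(4, n)) i j :
  (A *m B) i j = A i 0 * B 0 j + A i 1 * B 1 j + A i 2 * B 2 j + A i 3 * B 3 j.
Proof. by rewrite mxE sum_ord4. Qed.

Lemma subu2E (x y : u2 R) i j : (x - y) i j = x i j - y i j.
Proof. by rewrite !mxE. Qed.

Lemma mul_basis (b : 'M[R]_4) c r : (b *m u2_basis R c) r 0 = b r c.
Proof. by rewrite -colE mxE. Qed.

Lemma basisE c r : u2_basis R c r 0 = (r == c)%:R.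
Proof. by rewrite mxE andbT. Qed.

Lemma scaleu2E a (x : u2 R) i j : (a *: x) i j = a * x i j.
Proof. by rewrite mxE. Qed.

(** Brackets become combinations of basis vectors, so that [b *m _] distributes over them and
    [mul_basis] reads off entries of [b]: torsion at basis vectors turns into polynomials in the
    entries. *)
Lemma lie_basisr (e := u2_basis R) :
  [/\ forall x, lie x (e 0) = x 2 0 *: e 1 - x 1 0 *: e 2,
      forall x, lie x (e 1) = x 0 0 *: e 2 - x 2 0 *: e 0,
      forall x, lie x (e 2) = x 1 0 *: e 0 - x 0 0 *: e 1
    & forall x, lie x (e 3) = 0].
Proof.
split=> x; apply: u2P; split;
  rewrite ?(lie0E, lie1E, lie2E, lie3E) !mxE //= ?mulr0n ?mulr1n; ring.
Qed.

Lemma lie_basisl (e := u2_basis R) :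
  [/\ forall x, lie (e 0) x = x 1 0 *: e 2 - x 2 0 *: e 1,
      forall x, lie (e 1) x = x 2 0 *: e 0 - x 0 0 *: e 2,
      forall x, lie (e 2) x = x 0 0 *: e 1 - x 1 0 *: e 0
    & forall x, lie (e 3) x = 0].
Proof.
split=> x; apply: u2P; split;
  rewrite ?(lie0E, lie1E, lie2E, lie3E) !mxE //= ?mulr0n ?mulr1n; ring.
Qed.

Lemma mulu2B (b : 'M[R]_4) (x y : u2 R) :
  b *m (x - y) = (b *m x : u2 R) - b *m y.
Proof. exact: mulmxBr. Qed.

Lemma mulu2Z (b : 'M[R]_4) a (x : u2 R) : b *m (a *: x) = a *: (b *m x : u2 R).
Proof. by rewrite -scalemxAr. Qed.

Lemma zerou2E i j : (0 : u2 R) i j = 0.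
Proof. by rewrite mxE. Qed.

Lemma mulu20 (b : 'M[R]_4) : b *m (0 : u2 R) = 0.
Proof. exact: mulmx0. Qed.

Definition coordE := (subu2E, scaleu2E, zerou2E, lie0E, lie1E, lie2E, lie3E,
  mul_basis, basisE).

End U2.

(** * Torsion as a system of equations in the 4 x 4 blocks *)

Section Blocks.
Variables (R : realType) (N : nat).

Definition embed (j : 'I_N) (x : u2 R) : u2N R N :=
  [ffun i => if i == j then x else 0].

Lemma lie_embedl j x (Y : u2N R N) : lie (embed j x) Y = embed j (lie x (Y j)).
Proof.
by apply/ffunP => i; rewrite !ffunE; case: eqP => [->|]; rewrite ?lie0l.
Qed.

Lemma lie_embedr j (X : u2N R N) y : lie X (embed j y) = embed j (lie (X j) y).
Proof.
by apply/ffunP => i; rewrite !ffunE; case: eqP => [->|]; rewrite ?lie0r.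
Qed.

Lemma sum_embed (X : u2N R N) : X = \sum_j embed j (X j).
Proof.
apply/ffunP => i; rewrite sum_ffunE (bigD1 i) //= ffunE eqxx big1 ?addr0 //.
by move=> j /negPf ne_ji; rewrite ffunE eq_sym ne_ji.
Qed.

Definition blocks (J : {linear u2N R N -> u2N R N}) i j : 'M[R]_4 :=
  \matrix_(k < 4, l < 4) J (u2N_basis R j l) i k 0.

Lemma blocks_embed (J : {linear u2N R N -> u2N R N}) i j x :
  J (embed j x) i = blocks J i j *m x.
Proof.
have -> : embed j x = \sum_l x l 0 *: u2N_basis R j l.
  apply/ffunP => a; rewrite sum_ffunE !ffunE; case: eqP => [->|ne].
    apply/matrixP=> k z; rewrite ord1 summxE (bigD1 k) //= big1 ?addr0.
      by rewrite !(ffunE, mxE) !eqxx !mxE !eqxx mulr1.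
    by move=> l /negPf ne; rewrite !(ffunE, mxE) eqxx mxE eq_sym ne mulr0.
  by rewrite big1 // => l _; rewrite !ffunE; case: eqP => // _; rewrite scaler0.
apply/matrixP => k z; rewrite linear_sum sum_ffunE ord1 summxE mxE.
by apply: eq_bigr => l _; rewrite linearZ /= !(ffunE, mxE) mulrC.
Qed.

Lemma blocks_sum (J : {linear u2N R N -> u2N R N}) i X :
  J X i = \sum_j blocks J i j *m X j.
Proof.
rewrite {1}(sum_embed X) linear_sum sum_ffunE.
by apply: eq_bigr => j _; rewrite blocks_embed.
Qed.

(* The component in factor i of the torsion at (X, Y), for X supported in
   factor j and Y in factor k. *)
Definition block_torsion (B : 'I_N -> 'I_N -> 'M[R]_4) i j k (x y : u2 R)
    : u2 R :=
  lie (B i j *m x : u2 R) (B i k *m y) -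
  (if (j == i) && (k == i) then lie x y else 0) -
  B i k *m lie (B k j *m x : u2 R) y - B i j *m lie x (B j k *m y : u2 R).

(** Brackets are taken factor by factor, so for Y in factor k the bracket [J X, Y] lies in factor k
    and sees only row k of the blocks of J. General pairs follow by bilinearity. *)
Lemma zero_torsion_blocks (J : {linear u2N R N -> u2N R N}) :
  zero_torsion J <-> forall i j k x y, block_torsion (blocks J) i j k x y = 0.
Proof.
split=> [J0 i j k x y | B0 X Y].
  have /ffunP/(_ i) := J0 (embed j x) (embed k y).
  rewrite lie_embedl !lie_embedr lie_embedl !ffunE !blocks_embed => <-.
  rewrite /block_torsion (eq_sym j) (eq_sym k); congr (_ - _ - _ - _).
  case: (i =P j) => //= <-; case: eqP => //= _.
  by rewrite lie0r.
apply/ffunP => i; rewrite !ffunE.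
transitivity (\sum_j \sum_k block_torsion (blocks J) i j k (X j) (Y k)).
  2: by rewrite big1 // => j _; rewrite big1 // => k _; rewrite B0.
rewrite /block_torsion !blocks_sum.
under [RHS]eq_bigr => j _ do rewrite !sumrB.
rewrite !sumrB; congr (_ - _ - _ - _).
- by rewrite lie_suml; apply: eq_bigr => j _; rewrite lie_sumr.
- rewrite (bigD1 i) //= (bigD1 i) //= eqxx big1 => [|k /negPf -> //].
  rewrite addr0 big1 ?addr0 // => j /negPf ->; by rewrite big1.
- rewrite exchange_big /=; apply: eq_bigr => k _.
  by rewrite ffunE blocks_sum lie_suml mulmx_sumr.
- apply: eq_bigr => j _.
  by rewrite ffunE blocks_sum lie_sumr mulmx_sumr.
Qed.

(** The inverses [Q] of the automorphisms [P] are automorphisms too, and the conjugated torsion at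
    x, y is [Q i] applied to the original torsion at [P j *m x], [P k *m y]. *)
Lemma block_torsion_conj (B : 'I_N -> 'I_N -> 'M[R]_4) (P Q : 'I_N -> 'M[R]_4) :
  (forall i, Q i *m P i = 1%:M) -> (forall i, P i *m Q i = 1%:M) ->
  (forall i (x y : u2 R), P i *m lie x y = lie (P i *m x : u2 R) (P i *m y)) ->
  (forall i j k x y, block_torsion B i j k x y = 0) ->
  forall i j k x y,
    block_torsion (fun i j => Q i *m B i j *m P j) i j k x y = 0.
Proof.
move=> QP PQ Plie B0 i j k x y.
have Qlie a (u v : u2 R) : Q a *m lie u v = lie (Q a *m u : u2 R) (Q a *m v).
  rewrite -{1}[u]mul1mx -{1}[v]mul1mx -(PQ a) -!mulmxA -Plie mulmxA QP.
  by rewrite mul1mx.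
transitivity (Q i *m block_torsion B i j k (P j *m x) (P k *m y)); last first.
  by rewrite B0 mulmx0.
rewrite /block_torsion !mulmxBr -!mulmxA !Qlie !Plie !mulmxA !PQ !mul1mx.
congr (_ - _ - _ - _).
case: (j =P i) => [->|_] /=; last by rewrite mulmx0.
by case: (k =P i) => [->|_]; rewrite ?mulmx0 // Qlie !mulmxA !QP !mul1mx.
Qed.
End Blocks.

(** * Rotations and the automorphisms they induce on u(2) *)

Section SO3.
Variable R : realType.

Lemma det_mx22 (A : 'M[R]_2) : \det A = A 0 0 * A 1 1 - A 0 1 * A 1 0.
Proof.
have l0 : lift (0 : 'I_2) (0 : 'I_1) = 1 by exact: val_inj.
have l1 : lift (1 : 'I_2) (0 : 'I_1) = 0 by exact: val_inj.
rewrite (expand_det_row _ 0) !big_ord_recl big_ord0 /cofactor !det_mx11 !mxE.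
rewrite !l0 l1 /= expr0 expr1; ring.
Qed.

Lemma lift_ord3 :
  [/\ lift (0 : 'I_3) (0 : 'I_2) = 1, lift (0 : 'I_3) (1 : 'I_2) = 2,
      lift (1 : 'I_3) (0 : 'I_2) = 0, lift (1 : 'I_3) (1 : 'I_2) = 2
    & lift (2 : 'I_3) (0 : 'I_2) = 0 /\ lift (2 : 'I_3) (1 : 'I_2) = 1].
Proof. by split; rewrite -?(rwP andP); try split; apply: val_inj. Qed.

(** Indices in ['I_3] are added modulo 3; the cyclic order absorbs the sign of the cofactor. *)
Lemma cofactor3 (A : 'M[R]_3) i j :
  cofactor A i j = A (i + 1) (j + 1) * A (i + 2) (j + 2) -
                   A (i + 1) (j + 2) * A (i + 2) (j + 1).
Proof.
have [l00 l01 l10 l11 [l20 l21]] := lift_ord3.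
have [a11 a12 a21 a22] := add_ord3.
rewrite /cofactor det_mx22 !mxE.
by elim/forall_ord3: i; elim/forall_ord3: j;
  rewrite ?(l00, l01, l10, l11, l20, l21) ?(add0r, a11, a12, a21, a22) /=; ring.
Qed.

Lemma det_mx33 (A : 'M[R]_3) :
  \det A = A 0 0 * (A 1 1 * A 2 2 - A 1 2 * A 2 1)
         + A 0 1 * (A 1 2 * A 2 0 - A 1 0 * A 2 2)
         + A 0 2 * (A 1 0 * A 2 1 - A 1 1 * A 2 0).
Proof.
have [a11 a12 a21 a22] := add_ord3.
rewrite (expand_det_row _ 0) sum_ord3 !cofactor3.
by rewrite !(add0r, a11, a12, a21, a22).
Qed.

(** The adjugate is the inverse up to the determinant 1, hence it is the transpose. *)
Lemma SO_cofactor (A : 'M[R]_3) i j : SO A -> cofactor A i j = A i j.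
Proof.
case=> AA dA; suff /matrixP/(_ i j) : (\adj A)^T = A by rewrite !mxE.
by rewrite -[\adj A]mul1mx -AA -mulmxA mul_mx_adj dA mulmx1 trmxK.
Qed.

Lemma SO_cross (A : 'M[R]_3) : SO A ->
  [/\ [/\ A 0 0 = A 1 1 * A 2 2 - A 1 2 * A 2 1,
          A 0 1 = A 1 2 * A 2 0 - A 1 0 * A 2 2
        & A 0 2 = A 1 0 * A 2 1 - A 1 1 * A 2 0],
      [/\ A 1 0 = A 2 1 * A 0 2 - A 2 2 * A 0 1,
          A 1 1 = A 2 2 * A 0 0 - A 2 0 * A 0 2
        & A 1 2 = A 2 0 * A 0 1 - A 2 1 * A 0 0]
    & [/\ A 2 0 = A 0 1 * A 1 2 - A 0 2 * A 1 1,
          A 2 1 = A 0 2 * A 1 0 - A 0 0 * A 1 2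
        & A 2 2 = A 0 0 * A 1 1 - A 0 1 * A 1 0]].
Proof.
have [a11 a12 a21 a22] := add_ord3.
move=> soA; have c i j := esym (SO_cofactor i j soA).
by split; split; rewrite c cofactor3 ?add0r ?(a11, a12, a21, a22).
Qed.

Lemma Phi_blockE (A : 'M[R]_3) b :
  let P := Phi_block A b in
  [/\ [/\ P 0 0 = A 0 0, P 0 1 = A 0 1, P 0 2 = A 0 2 & P 0 3 = 0],
      [/\ P 1 0 = A 1 0, P 1 1 = A 1 1, P 1 2 = A 1 2 & P 1 3 = 0],
      [/\ P 2 0 = A 2 0, P 2 1 = A 2 1, P 2 2 = A 2 2 & P 2 3 = 0]
    & [/\ P 3 0 = 0, P 3 1 = 0, P 3 2 = 0 & P 3 3 = b]].
Proof.
(* Indices built by [lshift] and [rshift] agree with the numerals of ['I_4] only in value, so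
   entries are compared through natural numbers. *)
have eqP4 (k l k' l' : 'I_4) : k = k' :> nat -> l = l' :> nat ->
  Phi_block A b k l = Phi_block A b k' l' by move=> /val_inj -> /val_inj ->.
have Pul (k l : 'I_4) (i j : 'I_3) : k = i :> nat -> l = j :> nat ->
    Phi_block A b k l = A i j.
  move=> ki lj; rewrite -(block_mxEul A (0 : 'M_(3, 1)) (0 : 'M_(1, 3)) b%:M).
  exact: eqP4.
have Pur (k : 'I_4) (i : 'I_3) : k = i :> nat -> Phi_block A b k 3 = 0.
  move=> ki; transitivity ((0 : 'M[R]_(3, 1)) i 0); last by rewrite mxE.
  by rewrite -(block_mxEur A (0 : 'M_(3, 1)) (0 : 'M_(1, 3)) b%:M); exact: eqP4.
have Pdl (l : 'I_4) (j : 'I_3) : l = j :> nat -> Phi_block A b 3 l = 0.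
  move=> lj; transitivity ((0 : 'M[R]_(1, 3)) 0 j); last by rewrite mxE.
  by rewrite -(block_mxEdl A (0 : 'M_(3, 1)) (0 : 'M_(1, 3)) b%:M); exact: eqP4.
have Pdr : Phi_block A b 3 3 = b.
  transitivity ((b%:M : 'M[R]_1) 0 0); last by rewrite mxE.
  by rewrite -(block_mxEdr A (0 : 'M_(3, 1)) (0 : 'M_(1, 3)) b%:M); exact: eqP4.
move=> P; split; split; rewrite /P; first
  [exact: Pdr | exact: Pul | by apply: (Pur _ 0) | by apply: (Pur _ 1)
  | by apply: (Pur _ 2) | by apply: (Pdl _ 0) | by apply: (Pdl _ 1)
  | by apply: (Pdl _ 2)].
Qed.

(** On the first three coordinates the bracket is the cross product, which is transformed by the
    cofactor matrix, here [A] itself. The factor [b] acts on the central coordinate, where brackets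
    vanish. *)
Lemma Phi_block_lie (A : 'M[R]_3) b (x y : u2 R) : SO A ->
  Phi_block A b *m lie x y =
  lie (Phi_block A b *m x : u2 R) (Phi_block A b *m y).
Proof.
move=> /SO_cross[[c00 c01 c02] [c10 c11 c12] [c20 c21 c22]].
have [[p00 p01 p02 p03] [p10 p11 p12 p13]] := Phi_blockE A b.
move=> [p20 p21 p22 p23] [p30 p31 p32 p33].
apply: u2P; split; rewrite ?(lie0E, lie1E, lie2E, lie3E) !mul4_coord
  ?(lie0E, lie1E, lie2E, lie3E).
- rewrite p00 p01 p02 p03 p10 p11 p12 p13 p20 p21 p22 p23 c00 c01 c02; ring.
- rewrite p00 p01 p02 p03 p10 p11 p12 p13 p20 p21 p22 p23 c10 c11 c12; ring.
- rewrite p00 p01 p02 p03 p10 p11 p12 p13 p20 p21 p22 p23 c20 c21 c22; ring.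
- rewrite p30 p31 p32; ring.
Qed.

Lemma Phi_block_inv (A : 'M[R]_3) b : SO A -> 0 < b ->
  Phi_block A^T b^-1 *m Phi_block A b = 1%:M.
Proof.
move=> [AA _] b_gt0; apply: (etrans (mulmx_block A^T (0 : 'M_(3, 1))
  (0 : 'M_(1, 3)) (b^-1)%:M A (0 : 'M_(3, 1)) (0 : 'M_(1, 3)) b%:M)).
rewrite !mul0mx !mulmx0 AA.
by rewrite !addr0 !add0r -scalar_mxM mulVf ?gt_eqF // -scalar_mx_block.
Qed.

(* Coordinates for which the entries of the rotation are rational functions, so
   that no relation between x, y and z is needed to check orthogonality. *)
Lemma stereographic_rotation (a b : R) (D := 1 + a ^+ 2 + b ^+ 2) :
  exists2 A : 'M[R]_3, SO A &
    [/\ A 0 2 = 2 * a / D, A 1 2 = 2 * b / D & A 2 2 = (2 - D) / D].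
Proof.
have D0 : D != 0 by rewrite gt_eqF // /D -addrA ltr_pwDl // addr_ge0 ?sqr_ge0.
exists (\matrix_(i < 3, j < 3) (nth [::] [::
    [:: 1 - 2 * a ^+ 2 / D; - 2 * a * b / D; 2 * a / D];
    [:: - 2 * a * b / D; 1 - 2 * b ^+ 2 / D; 2 * b / D];
    [:: - 2 * a / D; - 2 * b / D; (2 - D) / D]] i)`_j); last first.
  by rewrite !mxE.
split.
  apply/matrixP; elim/forall_ord3; elim/forall_ord3;
    rewrite mxE sum_ord3 !mxE /=; rewrite /D in D0 *; by field.
rewrite det_mx33 !mxE /=; rewrite /D in D0 *; by field.
Qed.

Lemma rotation_last_col (x y z : R) : x ^+ 2 + y ^+ 2 + z ^+ 2 = 1 ->
  exists2 A : 'M[R]_3, SO A & [/\ A 0 2 = x, A 1 2 = y & A 2 2 = z].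
Proof.
move=> xyz; have [z1|z1] := eqVneq (1 + z) 0.
  (* The pole missed by the stereographic chart is reached by the half-turn about the first axis. *)
  have zE : z = - 1 by lra.
  have s0 : x ^+ 2 + y ^+ 2 = 0 by rewrite zE in xyz; lra.
  have [x0 y0] := sqr_add_eq0 s0.
  exists (\matrix_(i < 3, j < 3) (nth [::] [::
      [:: 1; 0; 0]; [:: 0; - 1; 0]; [:: 0; 0; - 1]] i)`_j).
    split.
      by apply/matrixP; elim/forall_ord3; elim/forall_ord3;
        rewrite mxE sum_ord3 !mxE /=; ring.
    by rewrite det_mx33 !mxE /=; ring.
  by rewrite !mxE x0 y0 zE.
(* These are the stereographic coordinates of (x, y, z) from the pole (0, 0, -1). *)
have [A soA [h0 h1 h2]] := stereographic_rotation (x / (1 + z)) (y / (1 + z)).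
have DE : 1 + (x / (1 + z)) ^+ 2 + (y / (1 + z)) ^+ 2 = 2 / (1 + z).
  have -> : 1 + (x / (1 + z)) ^+ 2 + (y / (1 + z)) ^+ 2 =
    (x ^+ 2 + y ^+ 2 + z ^+ 2 + 1 + 2 * z) / (1 + z) ^+ 2 by field.
  by rewrite xyz; field.
exists A => //; rewrite h0 h1 h2 DE; split; by field.
Qed.

End SO3.

(** * Normal form of the diagonal blocks *)

Section Diag.
Variable R : realType.

Lemma polar3 (a b c : R) : exists n x y z,
  [/\ 0 <= n, x ^+ 2 + y ^+ 2 + z ^+ 2 = 1, a = n * x, b = n * y & c = n * z].
Proof.
set s := a ^+ 2 + b ^+ 2 + c ^+ 2.
have s_ge0 : 0 <= s by rewrite !addr_ge0 ?sqr_ge0.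
have [s0|s0] := eqVneq s 0.
  move/eqP: s0; rewrite paddr_eq0 ?addr_ge0 ?sqr_ge0 // sqrf_eq0.
  move=> /andP[/eqP/sqr_add_eq0[-> ->] /eqP->].
  by exists 0, 0, 0, 1; split; rewrite ?mul0r //; ring.
have n0 : Num.sqrt s != 0 by rewrite gt_eqF // sqrtr_gt0 lt0r s0.
exists (Num.sqrt s), (a / Num.sqrt s), (b / Num.sqrt s), (c / Num.sqrt s).
split; rewrite ?sqrtr_ge0 //; try by field.
by rewrite !exprMn exprVn sqr_sqrtr // -!mulrDl divff.
Qed.

(** The differences of transposed entries of [A] form a vector n (x, y, z). A rotation with third
    column (x, y, z) carries the third axis onto its direction, and n >= 0 settles the sign. *)
Lemma SO_conj_antisym (A : 'M[R]_3) :
  exists2 Q : 'M[R]_3, SO Q & let B := Q^T *m A *m Q in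
    [/\ B 0 2 = B 2 0, B 1 2 = B 2 1 & B 1 0 <= B 0 1].
Proof.
have [n [x [y [z [n_ge0 u1 dx dy dz]]]]] :=
  polar3 (A 1 2 - A 2 1) (A 2 0 - A 0 2) (A 0 1 - A 1 0).
have [Q soQ [qx qy qz]] := rotation_last_col u1.
have mulE r c : (Q^T *m A *m Q) r c =
    (Q 0 r * A 0 0 + Q 1 r * A 1 0 + Q 2 r * A 2 0) * Q 0 c +
    (Q 0 r * A 0 1 + Q 1 r * A 1 1 + Q 2 r * A 2 1) * Q 1 c +
    (Q 0 r * A 0 2 + Q 1 r * A 1 2 + Q 2 r * A 2 2) * Q 2 c.
  by rewrite mxE sum_ord3 !mxE !sum_ord3 !mxE.
have [[c00 c01 c02] [c10 c11 c12] [c20 c21 c22]] := SO_cross soQ.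
(* The right-hand side is n times the triple product of (x, y, z) with columns r and c of [Q]. *)
have antiE r c : (Q^T *m A *m Q) r c - (Q^T *m A *m Q) c r =
    n * (x * (Q 1 r * Q 2 c - Q 2 r * Q 1 c) +
         y * (Q 2 r * Q 0 c - Q 0 r * Q 2 c) +
         z * (Q 0 r * Q 1 c - Q 1 r * Q 0 c)).
  rewrite !mulE !mulrDr !mulrA -dx -dy -dz; ring.
have orth r c : Q 0 r * Q 0 c + Q 1 r * Q 1 c + Q 2 r * Q 2 c = (r == c)%:R.
  by case: soQ => /matrixP/(_ r c) + _; rewrite mxE sum_ord3 !mxE.
have o02 : Q 0 0 * x + Q 1 0 * y + Q 2 0 * z = 0 by rewrite -qx -qy -qz orth.
have o12 : Q 0 1 * x + Q 1 1 * y + Q 2 1 * z = 0 by rewrite -qx -qy -qz orth.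
exists Q => // B; split.
- apply/eqP; rewrite -subr_eq0 antiE; apply/eqP.
  rewrite -[RHS](mulr0 (- n)) -{}o12 c01 c11 c21; ring.
- apply/eqP; rewrite -subr_eq0 antiE; apply/eqP.
  rewrite -[RHS](mulr0 n) -o02 c00 c10 c20; ring.
- rewrite -subr_ge0 antiE mulr_ge0 //.
  have -> : Q 0 0 * Q 1 1 - Q 1 0 * Q 0 1 = z by rewrite -qz c22; ring.
  have -> : Q 1 0 * Q 2 1 - Q 2 0 * Q 1 1 = x by rewrite -qx c02; ring.
  have -> : Q 2 0 * Q 0 1 - Q 0 0 * Q 2 1 = y by rewrite -qy c12; ring.
  by rewrite -!expr2 u1.
Qed.

Lemma block_torsion_coord N (B : 'I_N -> 'I_N -> 'M[R]_4) i j k c d r :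
  (forall x y, block_torsion B i j k x y = 0) ->
  block_torsion B i j k (u2_basis R c) (u2_basis R d) r 0 = 0.
Proof. by move=> ->; rewrite mxE. Qed.

(* The hypotheses are the entries of (A + A^T) (A^T - tr A) + (s - 1) = 0 for
   A = [p, g + w, f; g - w, q, e; f, e, r] and s = (tr A ^ 2 - tr (A ^ 2)) / 2;
   when w = 0 they say that the adjugate of the symmetric matrix A is - 1,
   so that - 1 = det (adj A) = (det A) ^ 2. *)
Lemma normal_form_scalars (p q r e f g w s : R) :
  0 <= w -> s = p * q + p * r + q * r - g ^+ 2 + w ^+ 2 - f ^+ 2 - e ^+ 2 ->
  2 * (g * (g + w) + f ^+ 2 - p * (q + r)) + s = 1 ->
  f * e - p * w - g * r = 0 ->
  g * e - f * q = 0 ->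
  q * w - g * r + e * f = 0 ->
  2 * (g * (g - w) + e ^+ 2 - q * (p + r)) + s = 1 ->
  g * f - p * e = 0 ->
  e * g + e * w - f * q = 0 ->
  f * g - f * w - e * p = 0 ->
  2 * (f ^+ 2 + e ^+ 2 - r * (p + q)) + s = 1 ->
  [/\ w = 1, p = 0, q = 0 & [/\ e = 0, f = 0 & g = 0]].
Proof.
move=> w_ge0 sE E00 E01 E02 E10 E11 E12 E20 E21 E22.
have [w0|w0] := eqVneq w 0.
  exfalso; rewrite w0 in sE E00 E11 E20 E21 E01 E10.
  have g2 : p * q - g ^+ 2 = - 1 by lra.
  have f2 : p * r - f ^+ 2 = - 1 by lra.
  have e2 : q * r - e ^+ 2 = - 1 by lra.
  set d := p * (q * r - e ^+ 2) - g * (g * r - e * f) + f * (g * e - q * f).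
  have d2 : d ^+ 2 = - 1.
    have gr : f * e - g * r = 0 by lra.
    have gf : g * f - p * e = 0 by lra.
    (* The new expression is the determinant of the adjugate, expanded as that of a symmetric 3 x 3
       matrix. *)
    transitivity ((p * q - g ^+ 2) * (p * r - f ^+ 2) * (q * r - e ^+ 2)
      - 2 * (f * e - g * r) * (g * f - p * e) * (f * q - g * e)
      - (q * r - e ^+ 2) * (g * f - p * e) ^+ 2
      - (p * r - f ^+ 2) * (g * e - f * q) ^+ 2
      - (p * q - g ^+ 2) * (f * e - g * r) ^+ 2); first by rewrite /d; ring.
    rewrite g2 f2 e2 gr gf E02; ring.
  by have := sqr_ge0 d; rewrite d2; lra.
(* Subtracting equations at transposed positions leaves e w = 0, f w = 0 and (p + q) w = 0. *)
have e0 : e = 0 by apply/eqP; rewrite -(mulIr_eq0 _ (mulIf w0)); apply/eqP; lra.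
have f0 : f = 0 by apply/eqP; rewrite -(mulIr_eq0 _ (mulIf w0)); apply/eqP; lra.
have pq : q = - p.
  apply/eqP; rewrite -addr_eq0 -(mulIr_eq0 _ (mulIf w0)); apply/eqP; lra.
rewrite e0 f0 pq in sE E00 E01 E11 E22.
(* Now [E22] reads s = 1, and the sum of [E00] and [E11] becomes 4 (p ^ 2 + g ^ 2) = 0. *)
have pg : p ^+ 2 + g ^+ 2 = 0 by lra.
have [p0 g0] := sqr_add_eq0 pg.
have w1 : w ^+ 2 = 1 by rewrite p0 g0 in sE E22; lra.
have w_1 : w = 1 by apply/eqP; rewrite -(eqrXn2 (n := 2)) // w1 expr1n.
by rewrite pq p0 oppr0.
Qed.

(** The entry [b 2 2] stays free, and so do the fourth row and column, which are treated together
    with the off-diagonal blocks. *)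
Definition so3_normal (b : 'M[R]_4) : Prop :=
  [/\ [/\ b 0 0 = 0, b 0 1 = 1 & b 0 2 = 0],
      [/\ b 1 0 = - 1, b 1 1 = 0 & b 1 2 = 0]
    & b 2 0 = 0 /\ b 2 1 = 0].

(** The first three coordinates of the torsion at three pairs of basis vectors give nine equations.
    With g and w the symmetric and skew parts of the entries (0, 1) and (1, 0), they yield the
    hypotheses of [normal_form_scalars]. *)
Lemma diag_normal_form N (B : 'I_N -> 'I_N -> 'M[R]_4) i (b := B i i) :
  (forall x y, block_torsion B i i i x y = 0) ->
  b 0 2 = b 2 0 -> b 1 2 = b 2 1 -> b 1 0 <= b 0 1 ->
  so3_normal b.
Proof.
move=> B0 h02 h12 h01.
have E c d r := block_torsion_coord c d r B0.
have [r0 r1 r2 r3] := lie_basisr R; have [l0 l1 l2 l3] := lie_basisl R.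
have lieE := (r0, r1, r2, r3, l0, l1, l2, l3, mulu2B, mulu2Z).
have E00 := E 1 2 0; have E10 := E 1 2 1; have E20 := E 1 2 2.
have E01 := E 2 0 0; have E11 := E 2 0 1; have E21 := E 2 0 2.
have E02 := E 0 1 0; have E12 := E 0 1 1; have E22 := E 0 1 2.
rewrite /block_torsion eqxx /= !subu2E !(lieE, coordE) /= in E00 E10 E20 E01 E11
  E21 E02 E12 E22.
rewrite -/b in E00 E10 E20 E01 E11 E21 E02 E12 E22; clearbody b; clear B0 E.
rewrite /so3_normal; set w := (b 0 1 - b 1 0) / 2; set g := (b 0 1 + b 1 0) / 2.
have b01 : b 0 1 = g + w by rewrite /g /w; field.
have b10 : b 1 0 = g - w by rewrite /g /w; field.
have w_ge0 : 0 <= w by rewrite /w divr_ge0 // subr_ge0.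
rewrite -h02 -h12 b01 b10 in E00 E10 E20 E01 E11 E21 E02 E12 E22 *.
case: (@normal_form_scalars (b 0 0) (b 1 1) (b 2 2) (b 1 2) (b 0 2) g w _ w_ge0
  erefl); try (clear -E00 E10 E20 E01 E11 E21 E02 E12 E22; lra).
by move=> -> -> -> [-> -> ->]; rewrite add0r sub0r.
Qed.
End Diag.

(** * The shape of the blocks of K(M), and its zero torsion *)

Section Shape.
Variable R : realType.

(** The values [d] = 1 and [d] = 0 serve the diagonal and the off-diagonal blocks; the lower right 2
    x 2 block is free. *)
Definition K_shape (d : R) (b : 'M[R]_4) : Prop :=
  [/\ [/\ b 0 0 = 0, b 0 1 = d, b 0 2 = 0 & b 0 3 = 0],
      [/\ b 1 0 = - d, b 1 1 = 0, b 1 2 = 0 & b 1 3 = 0],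
      b 2 0 = 0 /\ b 2 1 = 0 & b 3 0 = 0 /\ b 3 1 = 0].

Lemma K_blockE (U V : 'M[R]_2) :
  let b := K_block U V in
  [/\ [/\ b 0 0 = U 0 0, b 0 1 = U 0 1, b 0 2 = 0 & b 0 3 = 0],
      [/\ b 1 0 = U 1 0, b 1 1 = U 1 1, b 1 2 = 0 & b 1 3 = 0],
      [/\ b 2 0 = 0, b 2 1 = 0, b 2 2 = V 0 0 & b 2 3 = V 0 1] &
      [/\ b 3 0 = 0, b 3 1 = 0, b 3 2 = V 1 0 & b 3 3 = V 1 1]].
Proof.
have eqP4 (k l k' l' : 'I_4) : k = k' :> nat -> l = l' :> nat ->
  K_block U V k l = K_block U V k' l' by move=> /val_inj -> /val_inj ->.
have Pul (k l : 'I_4) (i j : 'I_2) : k = i :> nat -> l = j :> nat ->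
    K_block U V k l = U i j.
  move=> ki lj; rewrite -(block_mxEul U (0 : 'M_2) (0 : 'M_2) V); exact: eqP4.
have Pur (k l : 'I_4) (i j : 'I_2) : k = i :> nat -> l = (2 + j)%N :> nat ->
    K_block U V k l = 0.
  move=> ki lj; transitivity ((0 : 'M[R]_2) i j); last by rewrite mxE.
  by rewrite -(block_mxEur U (0 : 'M_2) (0 : 'M_2) V); exact: eqP4.
have Pdl (k l : 'I_4) (i j : 'I_2) : k = (2 + i)%N :> nat -> l = j :> nat ->
    K_block U V k l = 0.
  move=> ki lj; transitivity ((0 : 'M[R]_2) i j); last by rewrite mxE.
  by rewrite -(block_mxEdl U (0 : 'M_2) (0 : 'M_2) V); exact: eqP4.
have Pdr (k l : 'I_4) (i j : 'I_2) : k = (2 + i)%N :> nat ->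
    l = (2 + j)%N :> nat -> K_block U V k l = V i j.
  move=> ki lj; rewrite -(block_mxEdr U (0 : 'M_2) (0 : 'M_2) V); exact: eqP4.
move=> b; split; split; rewrite /b.
- exact: Pul. - exact: Pul. - exact: (Pur _ _ 0 0). - exact: (Pur _ _ 0 1).
- exact: Pul. - exact: Pul. - exact: (Pur _ _ 1 0). - exact: (Pur _ _ 1 1).
- exact: (Pdl _ _ 0 0). - exact: (Pdl _ _ 0 1). - exact: Pdr. - exact: Pdr.
- exact: (Pdl _ _ 1 0). - exact: (Pdl _ _ 1 1). - exact: Pdr. - exact: Pdr.
Qed.

Lemma K_cornerE :
  [/\ K_corner R 0 0 = 0, K_corner R 0 1 = 1,
      K_corner R 1 0 = - 1 & K_corner R 1 1 = 0].
Proof.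
have eqP2 (k l k' l' : 'I_2) : k = k' :> nat -> l = l' :> nat ->
  K_corner R k l = K_corner R k' l' by move=> /val_inj -> /val_inj ->.
pose O : 'M[R]_1 := 0; pose I : 'M[R]_1 := 1%:M.
split.
- transitivity (O 0 0); last by rewrite mxE.
  by rewrite -(block_mxEul O I (- I) O); exact: eqP2.
- transitivity (I 0 0); last by rewrite mxE.
  by rewrite -(block_mxEur O I (- I) O); exact: eqP2.
- transitivity ((- I) 0 0); last by rewrite !mxE.
  by rewrite -(block_mxEdl O I (- I) O); exact: eqP2.
- transitivity (O 0 0); last by rewrite mxE.
  by rewrite -(block_mxEdr O I (- I) O); exact: eqP2.
Qed.

Lemma K_shapeP (c : bool) (b : 'M[R]_4) :
  K_shape c%:R b <->
  exists V, b = K_block (if c then K_corner R else 0) V.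
Proof.
have [k00 k01 k10 k11] := K_cornerE; split; last first.
  move=> [V ->].
  have [[b00 b01 b02 b03] [b10 b11 b12 b13] [b20 b21 _ _] [b30 b31 _ _]] :=
    K_blockE (if c then K_corner R else 0) V.
  by split; split; rewrite // ?(b00, b01, b10, b11);
    case: (c); rewrite ?(k00, k01, k10, k11) ?mxE ?oppr0.
move=> [[b00 b01 b02 b03] [b10 b11 b12 b13] [b20 b21] [b30 b31]].
pose V : 'M[R]_2 := \matrix_(k < 2, l < 2)
  b (if k == 0 then 2 else 3) (if l == 0 then 2 else 3).
exists V.
have [[c00 c01 c02 c03] [c10 c11 c12 c13] [c20 c21 c22 c23] [c30 c31 c32 c33]]
  := K_blockE (if c then K_corner R else 0) V.
apply/matrixP; elim/forall_ord4; elim/forall_ord4.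
- by rewrite b00 c00; case: (c); rewrite ?k00 ?mxE.
- by rewrite b01 c01; case: (c); rewrite ?k01 ?mxE.
- by rewrite b02 c02.
- by rewrite b03 c03.
- by rewrite b10 c10; case: (c); rewrite ?k10 ?mxE ?oppr0.
- by rewrite b11 c11; case: (c); rewrite ?k11 ?mxE.
- by rewrite b12 c12.
- by rewrite b13 c13.
- by rewrite b20 c20.
- by rewrite b21 c21.
- by rewrite c22 mxE.
- by rewrite c23 mxE.
- by rewrite b30 c30.
- by rewrite b31 c31.
- by rewrite c32 mxE.
- by rewrite c33 mxE.
Qed.

(** The first two coordinates of [B a b *m z] are zero unless a = b, when they are those of z after
    a quarter-turn. Once it is known which of i, j, k coincide, each coordinate of the torsion is a
    polynomial identity. *)
Lemma K_shape_torsion N (B : 'I_N -> 'I_N -> 'M[R]_4) :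
  (forall i j, K_shape (i == j)%:R (B i j)) ->
  forall i j k x y, block_torsion B i j k x y = 0.
Proof.
move=> KB i j k x y.
have mulE a b (z : u2 R) (m := fun r => B a b r 2 * z 2 0 + B a b r 3 * z 3 0) :
    [/\ (B a b *m z) 0 0 = (a == b)%:R * z 1 0,
        (B a b *m z) 1 0 = - (a == b)%:R * z 0 0,
        (B a b *m z) 2 0 = m 2 & (B a b *m z) 3 0 = m 3].
  have [[b00 b01 b02 b03] [b10 b11 b12 b13] [b20 b21] [b30 b31]] := KB a b.
  rewrite /m; split; rewrite mul4_coord ?(b00, b01, b02, b03)
    ?(b10, b11, b12, b13) ?(b20, b21, b30, b31); ring.
have m0 a b (z : u2 R) : (B a b *m z) 0 0 = (a == b)%:R * z 1 0.
  by case: (mulE a b z).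
have m1 a b (z : u2 R) : (B a b *m z) 1 0 = - (a == b)%:R * z 0 0.
  by case: (mulE a b z).
have m2 a b (z : u2 R) :
    (B a b *m z) 2 0 = B a b 2 2 * z 2 0 + B a b 2 3 * z 3 0.
  by case: (mulE a b z).
have m3 a b (z : u2 R) :
    (B a b *m z) 3 0 = B a b 3 2 * z 2 0 + B a b 3 3 * z 3 0.
  by case: (mulE a b z).
have zif : (if (j == i) && (k == i) then lie x y else 0) =
    ((i == j)%:R * (i == k)%:R) *: lie x y.
  rewrite (eq_sym j) (eq_sym k).
  by case: (i == j); case: (i == k); rewrite ?(mulr1, mulr0, scale1r, scale0r).
rewrite /block_torsion zif; apply: u2P; split;
  rewrite !(subu2E, scaleu2E, zerou2E, lie0E, lie1E, lie2E, lie3E, m0, m1, m2,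
    m3) (eq_sym k j); clear;
  (have [eij|ij] := eqVneq i j; [subst j|]);
  (have [eik|ik] := eqVneq i k; [subst k|]);
  rewrite ?eqxx ?(eq_sym j i) ?(negPf ij) ?(negPf ik) /=;
  try ring; by case: (eqVneq j k) => [<-|_] /=; ring.
Qed.

(** * Torsion-free families with normalized diagonal blocks *)

Section OffDiagonal.
Variables (N : nat) (B : 'I_N -> 'I_N -> 'M[R]_4).
Hypothesis B0 : forall i j k x y, block_torsion B i j k x y = 0.
Hypothesis BD : forall i, so3_normal (B i i).

Lemma torsion_center i j : B i j 3 0 = 0 /\ B i j 3 1 = 0.
Proof.
have [r0 r1 r2 r3] := lie_basisr R; have [l0 l1 l2 l3] := lie_basisl R.
have lieE := (r0, r1, r2, r3, l0, l1, l2, l3, mulu2B, mulu2Z).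
have [[b00 b01 b02] [b10 b11 b12] [b20 b21]] := BD j.
have c1 := block_torsion_coord 1 2 3 (B0 i j j).
have c2 := block_torsion_coord 2 0 3 (B0 i j j).
have z (x y : u2 R) (c : bool) : (if c then lie x y else 0) 3 0 = 0.
  by case: c; rewrite coordE.
rewrite /block_torsion !(subu2E, z) !(lieE, coordE) in c1 c2.
rewrite ?(b00, b01, b02, b10, b11, b12, b20, b21) in c1 c2.
set a := B i j 3 0 in c1 c2 *; set b := B i j 3 1 in c1 c2 *.
(* Brackets have no fourth coordinate, so [c1] and [c2] say b = t a and a = - t b; multiplied by b
   and a, they combine to a ^ 2 + b ^ 2 = 0. *)
by case: (@sqr_add_eq0 R a b) => //; set t := B j j 2 2 in c1 c2;
  have := congr1 ( *%R b) c1; have := congr1 ( *%R a) c2; lra.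
Qed.

Lemma torsion_cols i j : j != i ->
  [/\ B i j 0 0 = 0, B i j 1 0 = 0 & B i j 2 0 = 0] /\
  [/\ B i j 0 1 = 0, B i j 1 1 = 0 & B i j 2 1 = 0].
Proof.
move=> ji; have [r0 r1 r2 r3] := lie_basisr R.
have [l0 l1 l2 l3] := lie_basisl R.
have lieE := (r0, r1, r2, r3, l0, l1, l2, l3, mulu2B, mulu2Z).
have [[b00 b01 b02] [b10 b11 b12] [b20 b21]] := BD j.
have c10 := block_torsion_coord 1 2 0 (B0 i j j).
have c11 := block_torsion_coord 1 2 1 (B0 i j j).
have c12 := block_torsion_coord 1 2 2 (B0 i j j).
have c20 := block_torsion_coord 2 0 0 (B0 i j j).
have c21 := block_torsion_coord 2 0 1 (B0 i j j).
have c22 := block_torsion_coord 2 0 2 (B0 i j j).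
rewrite /block_torsion (negPf ji) subr0 !subu2E !(lieE, coordE) in c10 c11 c12
  c20 c21 c22.
rewrite ?(b00, b01, b02, b10, b11, b12, b20, b21) in c10 c11 c12 c20 c21 c22.
move: c10 c11 c12 c20 c21 c22.
move: (B i j 0 0) (B i j 0 1) (B i j 0 2) (B i j 1 0) (B i j 1 1) (B i j 1 2)
  (B i j 2 0) (B i j 2 1) (B i j 2 2) (B j j 2 2).
clear=> u00 u01 u02 u10 u11 u12 u20 u21 u22 x c10 c11 c12 c20 c21 c22.
(* The equations for (J_2, J_3) and (J_3, J_1) are paired with the second and first column of the
   block. The cross products are orthogonal to these columns, and the terms in x cancel in the
   difference. *)
have S : u00 ^+ 2 + u10 ^+ 2 + u20 ^+ 2 + u01 ^+ 2 + u11 ^+ 2 + u21 ^+ 2 = 0.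
  have := congr1 ( *%R u00) c20; have := congr1 ( *%R u10) c21.
  have := congr1 ( *%R u20) c22; have := congr1 ( *%R u01) c10.
  have := congr1 ( *%R u11) c11; have := congr1 ( *%R u21) c12.
  clear; lra.
have := (sqr_ge0 u00, sqr_ge0 u10, sqr_ge0 u20).
have := (sqr_ge0 u01, sqr_ge0 u11, sqr_ge0 u21).
clear -S; move=> [[g3 g4] g5] [[g0 g1] g2].
by split; split; apply/eqP; rewrite -sqrf_eq0; apply/eqP; lra.
Qed.

Let rotation_dilation (x a b : R) : a = x * b -> b = - x * a -> a = 0 /\ b = 0.
Proof.
move=> ab ba; have b0 : b = 0.
  have e : b = - x * (x * b) by rewrite -ab.
  have /eqP : (1 + x ^+ 2) * b = 0 by rewrite mulrDl mul1r [X in X + _]e; ring.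
  by rewrite mulf_eq0 gt_eqF ?ltr_pwDl ?sqr_ge0 //= => /eqP.
by rewrite ab b0 mulr0.
Qed.

(** In the third coordinate of the torsion the term through [B k j] drops out: the second vector is
    central if c = 3, and the first two columns of [B k j] vanish if k differs from j. What remains
    is a = r b, b = - r a. *)
Lemma torsion_rows j k c : c = 3 \/ c = 2 /\ k != j ->
  B j k 0 c = 0 /\ B j k 1 c = 0.
Proof.
move=> hc; have [r0 r1 r2 r3] := lie_basisr R.
have [l0 l1 l2 l3] := lie_basisl R.
have lieE := (r0, r1, r2, r3, l0, l1, l2, l3, mulu2B, mulu2Z).
have [[b00 b01 b02] [b10 b11 b12] [b20 b21]] := BD j.
have c0 := block_torsion_coord 0 c 2 (B0 j j k).
have c1 := block_torsion_coord 1 c 2 (B0 j j k).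
rewrite /block_torsion eqxx /= in c0 c1.
have mul2 : B j k 0 c = B j j 2 2 * B j k 1 c /\
            B j k 1 c = - B j j 2 2 * B j k 0 c.
  case: hc => [cE|[cE kj]]; subst c.
    rewrite !r3 !if_same !mulu20 !(subu2E, zerou2E) !(lieE, coordE) in c0 c1.
    rewrite ?(b00, b01, b02, b10, b11, b12, b20, b21) in c0 c1.
    by split; lra.
  have jk : j != k by rewrite eq_sym.
  have [[p00 p10 _] [p01 p11 _]] := torsion_cols jk.
  rewrite (negPf kj) !(subu2E, zerou2E) !(lieE, coordE) in c0 c1.
  rewrite ?(b00, b01, b02, b10, b11, b12, b20, b21) in c0 c1.
  rewrite ?(p00, p01, p10, p11) in c0 c1.
  by split; lra.
case: mul2; exact: rotation_dilation.
Qed.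

Lemma torsion_K_shape i j : K_shape (i == j)%:R (B i j).
Proof.
have [c30 c31] := torsion_center i j.
have [h03 h13] := @torsion_rows i j 3 (or_introl erefl).
have [<-|ij] := eqVneq i j.
  have [[b00 b01 b02] [b10 b11 b12] [b20 b21]] := BD i.
  have [? ?] := @torsion_rows i i 3 (or_introl erefl).
  by have [? ?] := torsion_center i i.
have ji : j != i by rewrite eq_sym.
have [[p00 p10 p20] [p01 p11 p21]] := torsion_cols ji.
have [h02 h12] := @torsion_rows i j 2 (or_intror (conj erefl ji)).
by rewrite /K_shape oppr0.
Qed.
End OffDiagonal.

End Shape.

(** * Assembly of the blocks into matrices *)

Lemma SO_tr (R : realType) n (A : 'M[R]_n) : SO A -> SO A^T.
Proof. by move=> [AA dA]; split; rewrite ?det_tr ?trmxK // mulmx1C. Qed.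

Lemma mul_mxdiag (R : pzSemiRingType) n (p : 'I_n -> nat)
    (P Q : forall i, 'M[R]_(p i)) :
  (\mxdiag_i P i) *m (\mxdiag_i Q i) = \mxdiag_i (P i *m Q i).
Proof.
rewrite [X in _ *m X = _]/mxdiag mul_mxdiag_mxblock.
apply/eq_mxblockP => i j; case: eqVneq => [<-|_]; last by rewrite mulmx0.
by rewrite !conform_mx_id.
Qed.

Section Main.
Variables (R : realType) (N : nat).

Lemma Phi_conj_block (J : {linear u2N R N -> u2N R N}) (A : 'I_N -> 'M[R]_3)
    (b : 'I_N -> R) (Phi := \mxdiag_(i < N) Phi_block (A i) (b i)) :
  (forall i, SO (A i) /\ 0 < b i) ->
  invmx Phi *m matrix_of J *m Phi =
  \mxblock_(i < N, j < N)
    (Phi_block (A i)^T (b i)^-1 *m blocks J i j *m Phi_block (A j) (b j)).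
Proof.
move=> Ab; set Q := \mxdiag_(i < N) Phi_block (A i)^T (b i)^-1.
have QP : Q *m Phi = 1%:M.
  transitivity (\mxdiag_(i < N) (1%:M : 'M[R]_4)); last exact: mxdiagZ.
  rewrite /Q /Phi mul_mxdiag; apply/eq_mxdiagP => i.
  by case: (Ab i); exact: Phi_block_inv.
have [_ uPhi] := mulmx1_unit QP.
have -> : invmx Phi = Q by rewrite -[LHS]mul1mx -QP mulmxK.
by rewrite /Q /Phi mul_mxdiag_mxblock mul_mxblock_mxdiag.
Qed.

Lemma KmxP (B : 'I_N -> 'I_N -> 'M[R]_4) :
  (exists M, \mxblock_(i < N, j < N) B i j = Kmx M) <->
  (forall i j, K_shape (i == j)%:R (B i j)).
Proof.
split=> [[M] + i j|KB].
  rewrite /Kmx => /eq_mxblockP BK; apply/K_shapeP.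
  by exists (submxblock M i j); exact: BK.
(* The boolean equality lets [xchoose] select all blocks of [M] at once. *)
have V_ex i j : exists V, B i j == K_block (if i == j then K_corner R else 0) V.
  by have /K_shapeP[V ->] := KB i j; exists V.
exists (\mxblock_(i < N, j < N) xchoose (V_ex i j)); apply/eq_mxblockP => i j.
rewrite mxblockK; exact/eqP/(xchooseP (V_ex i j)).
Qed.

(** This carries [SO_conj_antisym] to the upper left 3 x 3 block, with scale 1 on the centre. *)
Lemma normalizing_rotation (b : 'M[R]_4) : exists2 A : 'M[R]_3, SO A &
  let c := Phi_block A^T 1 *m b *m Phi_block A 1 in
  [/\ c 0 2 = c 2 0, c 1 2 = c 2 1 & c 1 0 <= c 0 1].
Proof.
pose emb : 'I_3 -> 'I_4 := lift ord_max.
have [A soA] := SO_conj_antisym (\matrix_(k < 3, l < 3) b (emb k) (emb l)).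
have e0 : emb 0 = 0 by exact: val_inj.
have e1 : emb 1 = 1 by exact: val_inj.
have e2 : emb 2 = 2 by exact: val_inj.
move=> h; exists A => // c.
have [[p00 p01 p02 p03] [p10 p11 p12 p13] [p20 p21 p22 p23] _] :=
  Phi_blockE A^T 1.
have [[q00 q01 q02 _] [q10 q11 q12 _] [q20 q21 q22 _] [q30 q31 q32 _]] :=
  Phi_blockE A 1.
suff cE (k l : 'I_3) : c (emb k) (emb l) =
    (A^T *m (\matrix_(k < 3, l < 3) b (emb k) (emb l)) *m A) k l.
  by move: h; rewrite /= -!cE e0 e1 e2.
rewrite /c !mul4_coord [RHS]mxE sum_ord3 ![(A^T *m _) _ _]mxE !sum_ord3.
rewrite ![(\matrix_(_, _) _) _ _]mxE e0 e1 e2.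
by elim/forall_ord3: k; elim/forall_ord3: l; rewrite ?(e0, e1, e2) ?(p00, p01,
  p02, p03, p10, p11, p12, p13) ?(p20, p21, p22, p23) ?(q00, q01, q02, q10, q11)
  ?(q12, q20, q21, q22, q30, q31, q32); ring.
Qed.

End Main.

Theorem theorem5 (R : realType) (N : nat) (N_gt0 : (1 <= N)%N)
    (J : {linear u2N R N -> u2N R N}) :
  zero_torsion J <->
  exists (Phi : 'M[R]_(\sum_(i < N) 4)) (M : 'M[R]_(\sum_(i < N) 2)),
    SO3_Rpos_pow Phi /\ invmx Phi *m matrix_of J *m Phi = Kmx M.
Proof.
have PQ A (b : R) : SO A -> 0 < b ->
    Phi_block A b *m Phi_block A^T b^-1 = 1%:M.
  by move=> soA b0; apply: mulmx1C; exact: Phi_block_inv.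
split=> [/zero_torsion_blocks J0 | [Phi [M [[A [b [Ab ->]]] JK]]]].
  (* Each factor is rotated according to its own diagonal block; every scale [b i] is taken to be
     1. *)
  have [A soA nA] :=
    fin_all_exists2 (fun i => normalizing_rotation (blocks J i i)).
  exists (\mxdiag_(i < N) Phi_block (A i) 1).
  have A1 i : SO (A i) /\ 0 < 1 :> R by split.
  rewrite (Phi_conj_block J A1).
  set B := fun i j =>
    Phi_block (A i)^T 1^-1 *m blocks J i j *m Phi_block (A j) 1.
  have B0 : forall i j k x y, block_torsion B i j k x y = 0.
    apply: block_torsion_conj J0 => i; first exact: Phi_block_inv.
      exact: PQ.
    by move=> x y; exact: Phi_block_lie.
  have [i j|M BM] := (KmxP B).2.
    apply: torsion_K_shape => // {}i; have [] := nA i.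
    by rewrite -[X in Phi_block _ X *m _]invr1; exact: diag_normal_form.
  by exists M; split=> //; exists A, (fun=> 1); split.
apply/zero_torsion_blocks.
rewrite (Phi_conj_block J Ab) in JK.
have /KmxP KB := ex_intro (fun M => _ = Kmx M) M JK.
pose P i := Phi_block (A i) (b i); pose Q i := Phi_block (A i)^T (b i)^-1.
have PQ1 i : P i *m Q i = 1%:M by case: (Ab i); exact: PQ.
have QP1 i : Q i *m P i = 1%:M by case: (Ab i); exact: Phi_block_inv.
have Qlie i (x y : u2 R) : Q i *m lie x y = lie (Q i *m x : u2 R) (Q i *m y).
  by apply: Phi_block_lie; apply: SO_tr; case: (Ab i).
move=> i j k x y.
(* [P] and [Q] exchange roles: the blocks of K(M) are conjugated back to those of [J]. *)
rewrite -[RHS](block_torsion_conj PQ1 QP1 Qlie (K_shape_torsion KB) i j k x y).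
have cancel a c : P a *m (Q a *m blocks J a c *m P c) *m Q c = blocks J a c.
  by rewrite !mulmxA PQ1 mul1mx -mulmxA PQ1 mulmx1.
by rewrite /block_torsion !cancel.
Qed.
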